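(* For real $h>0$ and $n\in\mathbb{Z}$, let $$a_n(h)=h\exp\left(2nh-e^{nh}\right),\qquad b_n(h)=e^{nh}.$$ Then, for every $h>0$ and every real $t\geq 0$, $$\left|\frac{1}{(1+t)^2}-\sum_{n\in\mathbb{Z}}a_n(h)e^{-b_n(h)t}\right|\leq\frac{\delta(h)}{(1+t)^2},$$ where $$\delta(h)=\frac{4}{\exp\left(\frac{2\pi\lambda_0}{h}\right)-1}.$$
   Context: Here $\lambda_0=\sqrt{\frac{\pi^2}{6}-1}$. *)

(* Defs.v *)
From HB Require Import structures.
From mathcomp Require Import all_boot all_order all_algebra.
From mathcomp Require Import all_classical all_reals all_analysis.

Set Implicit Arguments.
Unset Strict Implicit.
Unset Printing Implicit Defensive.

Import Order.TTheory GRing.Theory Num.Theory.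
Import numFieldNormedType.Exports.

Local Open Scope ring_scope.

Definition lambda0 (R : realType) : R := Num.sqrt (pi ^+ 2 / 6 - 1).

Definition a (R : realType) (h : R) (n : int) : R :=
  h * expR (2 * n%:~R * h - expR (n%:~R * h)).

Definition b (R : realType) (h : R) (n : int) : R := expR (n%:~R * h).

(* For h > 0 all the terms are positive, so the bilateral series is an
   unordered sum in [0, +oo]; it takes the value +oo exactly when the series
   diverges, so a finite bound on the error includes convergence. *)
Definition exp_sum (R : realType) (h t : R) : \bar R :=
  (\esum_(n in [set: int]) (a h n * expR (- b h n * t))%:E)%E.

Definition delta (R : realType) (h : R) : R :=
  4 / (expR (2 * pi * lambda0 R / h) - 1).

(* Main.v *)
Require Import Defs.
From mathcomp Require Import all_boot all_order all_algebra.
From mathcomp Require Import all_classical all_reals all_analysis.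
From mathcomp Require Import ring lra.
Set Implicit Arguments.
Unset Strict Implicit.
Unset Printing Implicit Defensive.
Import Order.TTheory GRing.Theory Num.Theory.
Import numFieldNormedType.Exports.
Local Open Scope ring_scope.

(** Put sigma = 1 + t and g(x) = (sigma e^x)^2 exp (- sigma e^x).  Multiplied by
    (1 + t)^2, the exponential sum becomes the trapezoidal sum of h g(n h) over
    the integers n, whereas the integral of g over the line is Gamma(2) = 1: the
    statement bounds the error of the trapezoidal rule for g.  By Poisson
    summation this error is the sum over k <> 0 of the Fourier transform of g at
    the frequencies w = 2 pi k / h, and the modulus of this transform at w is
    |Gamma(2 + i w)|.  Hence everything follows from

      |Gamma(2 + i w)| <= 2 exp (- lambda0 |w|),

    because 4 times the sum over k >= 1 of exp (- 2 pi lambda0 k / h) is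
    delta(h) ([delta_geometric]).

    Decay of the Gamma function ([gcos_decay]).  The equation
    Gamma(z + 1) = z Gamma(z) and the bound |Gamma(n + i w)| <= Gamma(n) give
    |Gamma(2 + i w)|^2 * prod_(2 <= j <= n) (1 + (w / j)^2) <= 1 for all n.  The
    logarithm of the product is compared with an integral in closed form
    ([sum_ln_ge], [prod_decay]), which reduces the bound to an inequality between
    elementary functions of one variable, convex in w / 3, proved by means of one
    tangent line ([ln_atan_ge]).

    Poisson summation.  Only the upper bound for the error is needed, and it is
    obtained from the Fejer kernel F_n of period h ([fejer], with integral n h
    over a period).  The integral of g F_n over the line is n plus a combination
    of values of the Fourier transform of g, hence differs from n by at most
    n delta(h).  It also differs from n times the trapezoidal sum by a quantity
    bounded independently of n ([trapezoid_error]): on the cell around a node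
    the Taylor expansion of g has a linear term, killed by the parity of F_n, and
    a quadratic remainder, absorbed by sin^2 (pi v / h) F_n(v) <= 1.  Dividing by
    n and letting n grow gives the bound ([trapezoid_limit]).

    All integrals are taken over the bounded intervals formed by 2 M + 1 cells,
    and M tends to infinity at the end. *)

(** * Derivatives of real functions *)

(** Unlike [is_derive], this is not a type class: the rules below are applied
    by hand, in pointwise form, to functions written as lambda-terms. *)
Definition has_deriv (R : realType) (f : R -> R) (x d : R) : Prop :=
  is_derive x 1 f d.

Section Derivatives.
Local Open Scope classical_set_scope.
Context {R : realType}.
Implicit Types (f g : R -> R) (x : R).

Lemma has_deriv_eq f x d d' : has_deriv f x d -> d = d' -> has_deriv f x d'.
Proof. by move=> ? <-. Qed.

Lemma has_deriv_cst (c x : R) : has_deriv (fun _ => c) x 0.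
Proof. exact: is_derive_cst. Qed.

Lemma has_deriv_id x : has_deriv (fun y => y) x 1.
Proof. exact: is_derive_id. Qed.

Lemma has_derivD f g x df dg : has_deriv f x df -> has_deriv g x dg ->
  has_deriv (fun y => f y + g y) x (df + dg).
Proof. by move=> ? ?; exact: is_deriveD. Qed.

Lemma has_derivN f x df : has_deriv f x df -> has_deriv (fun y => - f y) x (- df).
Proof. by move=> ?; exact: is_deriveN. Qed.

Lemma has_derivM f g x df dg : has_deriv f x df -> has_deriv g x dg ->
  has_deriv (fun y => f y * g y) x (df * g x + f x * dg).
Proof.
move=> Df Dg; apply: is_derive_eq (is_deriveM Df Dg) _.
by rewrite /GRing.scale /=; ring.
Qed.

Lemma has_derivV f x df : f x != 0 -> has_deriv f x df ->
  has_deriv (fun y => (f y)^-1) x (- df / f x ^+ 2).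
Proof.
move=> fx0 Df; apply: is_derive_eq (is_deriveV fx0 Df) _.
by rewrite /GRing.scale /= !mulNr mulrC.
Qed.

Lemma has_derivX f n x df : has_deriv f x df ->
  has_deriv (fun y => f y ^+ n) x (n%:R * f x ^+ n.-1 * df).
Proof.
rewrite /has_deriv => Df; case: n => [|n].
  by rewrite !mul0r; exact: is_derive_cst.
have D := @is_deriveX _ _ f n x 1 df Df.
have -> : (fun y => f y ^+ n.+1) = f ^+ n.+1 by rewrite exprfctE.
by apply: is_derive_eq; rewrite /GRing.scale /= mulr_natl.
Qed.

Lemma has_deriv_comp f g x df dg : has_deriv f (g x) df -> has_deriv g x dg ->
  has_deriv (fun y => f (g y)) x (df * dg).
Proof. by rewrite /has_deriv => ? ?; exact: is_derive1_comp. Qed.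

Lemma has_deriv_expR x : has_deriv expR x (expR x).
Proof. exact: is_derive_expR. Qed.

Lemma has_deriv_sin x : has_deriv sin x (cos x).
Proof. exact: is_derive_sin. Qed.

Lemma has_deriv_cos x : has_deriv cos x (- sin x).
Proof. exact: is_derive_cos. Qed.

Lemma has_deriv_atan x : has_deriv atan x (1 + x ^+ 2)^-1.
Proof. exact: is_derive1_atan. Qed.

Lemma has_deriv_ln x : 0 < x -> has_deriv (@ln R) x x^-1.
Proof. exact: is_derive1_ln. Qed.

Lemma has_deriv_continuous f x d : has_deriv f x d -> {for x, continuous f}.
Proof. by case=> df _; exact/differentiable_continuous/derivable1_diffP. Qed.

Lemma MVT_has_deriv f (df : R -> R) (a b : R) : a <= b ->
  (forall x, a <= x <= b -> has_deriv f x (df x)) ->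
  exists2 c, a <= c <= b & f b - f a = df c * (b - a).
Proof.
move=> ab Df.
have cf : {within `[a, b], continuous f}.
  apply: continuous_in_subspaceT => x; rewrite inE /= in_itv /= => /Df.
  exact: has_deriv_continuous.
have Df' x : x \in `]a, b[%R -> is_derive x 1 f (df x).
  by rewrite in_itv /= => /andP[ax xb]; apply: Df; rewrite !ltW.
by have [c cab E] := MVT_segment ab Df' cf; exists c => //; rewrite in_itv in cab.
Qed.

Lemma has_deriv_nondecreasing f (df : R -> R) (a b : R) : a <= b ->
  (forall x, a <= x <= b -> has_deriv f x (df x)) ->
  (forall x, a <= x <= b -> 0 <= df x) -> f a <= f b.
Proof.
move=> ab /(MVT_has_deriv ab)[c cab E] df0.
by rewrite -subr_ge0 E mulr_ge0 ?subr_ge0 ?df0.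
Qed.

End Derivatives.

(** What remains after [derive] are the side conditions of the rules and the
    equation between the computed and the announced derivative. *)
Ltac derive_step := first
  [ apply: has_deriv_cst | apply: has_deriv_id
  | apply: has_derivD | apply: has_derivN | apply: has_derivM
  | apply: has_derivV | apply: has_derivX
  | apply: has_deriv_expR | apply: has_deriv_sin | apply: has_deriv_cos
  | apply: has_deriv_atan | apply: has_deriv_ln
  | apply: (has_deriv_comp (f := sin))
  | apply: (has_deriv_comp (f := cos))
  | apply: (has_deriv_comp (f := atan))
  | apply: (has_deriv_comp (f := @ln _)) ].

Ltac derive := apply: has_deriv_eq; [repeat derive_step | ].

(** * Numerical bounds *)

Ltac nneg := repeat first
  [ exact: ler0n | rewrite invr_ge0 | by apply: exprn_even_ge0 | apply: exprn_ge0
  | apply: mulr_ge0 | apply: addr_ge0 | done ].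

Section Numerics.
Context {R : realType}.
Implicit Types (x z w : R).

Lemma atan_ge_pade z : 0 <= z -> 3 * z / (3 + z ^+ 2) <= atan z.
Proof.
move=> z0; rewrite -subr_ge0.
pose f y : R := atan y - 3 * y / (3 + y ^+ 2).
have f0 : f 0 = 0 by rewrite /f atan0 mulr0 mul0r subr0.
rewrite -/(f z) -f0.
apply: (@has_deriv_nondecreasing _ f
  (fun y => 4 * y ^+ 4 / ((1 + y ^+ 2) * (3 + y ^+ 2) ^+ 2))) => [//|x _|x _].
- have p1 : 1 + x ^+ 2 != 0 by rewrite gt_eqF// ltr_pwDl ?sqr_ge0.
  have p3 : 3 + x ^+ 2 != 0 by rewrite gt_eqF// ltr_pwDl ?sqr_ge0.
  by derive => //=; field; rewrite p1 p3.
- by nneg.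
Qed.

(** The integrand is that of the classical identity
    22/7 - pi = \int_0^1 y^4 (1 - y)^4 / (1 + y^2) dy. *)
Lemma pi_le : pi <= 22 / 7 :> R.
Proof.
pose f y : R := y ^+ 7 / 7 - 2 * y ^+ 6 / 3 + y ^+ 5 - 4 * y ^+ 3 / 3 + 4 * y
  - 4 * atan y.
have f1 : f 0 <= f 1.
  apply: (@has_deriv_nondecreasing _ f
    (fun y => y ^+ 4 * (1 - y) ^+ 4 / (1 + y ^+ 2))) => [//|x _|x _]; last by nneg.
  have p1 : 1 + x ^+ 2 != 0 by rewrite gt_eqF// ltr_pwDl ?sqr_ge0.
  by derive => //=; field.
have f0 : f 0 = 0 by rewrite /f atan0 !expr0n /=; ring.
move: f1; rewrite f0 /f !expr1n atan1; lra.
Qed.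

Lemma pi_ge3 : 3 <= pi :> R.
Proof.
have := @atan_ge_pade 1 ler01; rewrite atan1 expr1n.
have -> : 3 * 1 / (3 + 1) = 3 / 4 :> R by field.
lra.
Qed.

Lemma lambda0_gt0 : 0 < lambda0 R.
Proof. by rewrite /lambda0 sqrtr_gt0; have := pi_ge3; nra. Qed.

Lemma lambda0_le : lambda0 R <= 201 / 250.
Proof.
have p0 := @pi_ge3; have p1 := pi_le.
have h : (201 / 250 : R) = Num.sqrt ((201 / 250) ^+ 2).
  by rewrite sqrtr_sqr ger0_norm ?divr_ge0 ?ler0n.
by rewrite h /lambda0; apply: ler_wsqrtr; nra.
Qed.

Lemma expR_18_19 : expR (18 / 19) <= (83 / 50) ^+ 2 :> R.
Proof.
have -> : 18 / 19 = 9 / 152 * 16%:R :> R by field.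
rewrite expRM_natr.
set r := expR _; have r0 : 0 < r by exact: expR_gt0.
have r1 : r <= 50 / 47.
  have : expR (- (9 / 152)) >= 1 - 9 / 152 :> R by exact: expR_ge1Dx.
  rewrite expRN -/r => e.
  have : r * (1 - 9 / 152) <= r * r^-1 by rewrite ler_pM2l.
  rewrite divff ?gt_eqF//; lra.
have sq (a b c : R) : 0 < a -> a <= b -> b ^+ 2 <= c -> a ^+ 2 <= c.
  move=> a0 ab; apply: le_trans.
  by rewrite ler_sqr ?nnegrE ?(ltW a0)// (le_trans (ltW a0)).
(* 50/47, 17/15, 9/7 and 83/50 are upper bounds, rounded upwards, for r and its
   successive squares. *)
rewrite (_ : 16%N = (2 * (2 * (2 * 2)))%N)// !exprM.
apply: (sq _ (83 / 50)) => //; first by rewrite !exprn_gt0.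
apply: (sq _ (9 / 7)); [by rewrite !exprn_gt0| |lra].
apply: (sq _ (17 / 15)); [by rewrite !exprn_gt0| |lra].
by apply: (sq _ (50 / 47)) => //; lra.
Qed.

Lemma ln_38_7 : 18 / 19 <= ln (38 / 5) - 3 * ln (7 / 5) :> R.
Proof.
have p1 : 0 < 7 / 5 :> R by rewrite divr_gt0.
have p2 : 0 < 38 / 5 :> R by rewrite divr_gt0.
have -> : 3 * ln (7 / 5) = ln ((7 / 5) ^+ 3) :> R.
  by rewrite lnXn// mulr_natl.
rewrite -ln_div ?posrE ?exprn_gt0//.
rewrite -(@expRK R (18 / 19)) ler_ln ?posrE ?expR_gt0 ?divr_gt0 ?exprn_gt0//.
by apply: le_trans expR_18_19 _; rewrite ler_pdivlMr ?exprn_gt0//; lra.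
Qed.

Lemma has_deriv_tangent (f df : R -> R) (a z : R) : 0 <= a -> 0 <= z ->
  (forall x, 0 <= x -> has_deriv f x (df x)) ->
  (forall x y, 0 <= x -> x <= y -> df x <= df y) ->
  f a + df a * (z - a) <= f z.
Proof.
move=> a0 z0 Df mono; have [az|/ltW za] := leP a z.
- have [|c /andP[ac cz] E] := @MVT_has_deriv _ f df a z az.
    by move=> x /andP[ax _]; apply: Df; exact: le_trans ax.
  by rewrite -lerBrDl E ler_wpM2r ?subr_ge0 ?mono.
- have [|c /andP[zc ca] E] := @MVT_has_deriv _ f df z a za.
    by move=> x /andP[zx _]; apply: Df; exact: le_trans zx.
  have -> : f a = f z + df c * (a - z) by rewrite -E; ring.
  rewrite -subr_ge0 (_ : _ - _ = (df a - df c) * (a - z)); last by ring.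
  by rewrite mulr_ge0 ?subr_ge0 ?mono// (le_trans z0).
Qed.

(** The right-hand side is convex in [z].  Its tangent at sqrt (2/5), close to
    the point where the two sides are closest, has a nonnegative intercept
    ([ln_38_7]) and a slope above 6 lambda0. *)
Lemma ln_atan_ge z : 0 <= z ->
  6 * lambda0 R * z <= ln (4 + 9 * z ^+ 2) - 3 * ln (1 + z ^+ 2) + 6 * z * atan z.
Proof.
move=> z0.
pose f y : R := ln (4 + 9 * y ^+ 2) - 3 * ln (1 + y ^+ 2) + 6 * y * atan y.
pose df y : R := 18 * y / (4 + 9 * y ^+ 2) + 6 * atan y.
pose ddf y : R := (168 + 342 * y ^+ 2 + 324 * y ^+ 4) /
   ((1 + y ^+ 2) * (4 + 9 * y ^+ 2) ^+ 2).
have p1 x : 0 < 1 + x ^+ 2 by rewrite ltr_pwDl ?sqr_ge0.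
have p4 x : 0 < 4 + 9 * x ^+ 2 by rewrite ltr_pwDl//; nneg.
have Df x : has_deriv f x (df x).
  derive => //=; rewrite /df; field.
  by rewrite !gt_eqF.
have Ddf x : has_deriv df x (ddf x).
  derive => /=; rewrite ?gt_eqF// /ddf; field.
  by rewrite !gt_eqF.
have mono x y : 0 <= x -> x <= y -> df x <= df y.
  move=> _ xy; apply: (@has_deriv_nondecreasing _ df ddf) => [//|t _|t _].
    exact: Ddf.
  by rewrite /ddf; nneg.
pose a : R := Num.sqrt (2 / 5).
have a0 : 0 <= a by rewrite sqrtr_ge0.
have a2 : a ^+ 2 = 2 / 5 by rewrite sqr_sqrtr// divr_ge0.
have a_ge : 63 / 100 <= a by nra.
have tangent : f a + df a * (z - a) <= f z by exact: has_deriv_tangent.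
rewrite -/(f z); apply: le_trans tangent.
clear Df Ddf mono p1 p4.
have slope : 6 * lambda0 R <= df a.
  have := atan_ge_pade a0; have := lambda0_le; rewrite /df a2.
  rewrite (_ : 4 + 9 * (2 / 5) = 38 / 5); last by field.
  rewrite (_ : 3 + 2 / 5 = 17 / 5); last by field.
  lra.
have intercept : 0 <= f a - df a * a.
  rewrite (_ : _ - _ = ln (4 + 9 * a ^+ 2) - 3 * ln (1 + a ^+ 2)
                       - 18 * a ^+ 2 / (4 + 9 * a ^+ 2)); last first.
    by rewrite /f /df; ring.
  rewrite a2 (_ : 4 + 9 * _ = 38 / 5); last by field.
  rewrite (_ : 1 + 2 / 5 = 7 / 5); last by field.
  rewrite (_ : 18 * _ / _ = 18 / 19); last by field.
  by rewrite subr_ge0 ln_38_7.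
have : 6 * lambda0 R * z <= df a * z by rewrite ler_wpM2r.
lra.
Qed.

End Numerics.

(** * The decay of a product *)

Section ProductDecay.
Context {R : realType}.
Implicit Types (Q w x : R).

Let Psi w x : R := x * ln (1 + (w / x) ^+ 2) - 2 * w * atan (w / x).

Let one_sqr_gt0 x : 0 < 1 + x ^+ 2.
Proof. by rewrite ltr_pwDl ?sqr_ge0. Qed.

Lemma has_deriv_Psi w x : 0 < x -> has_deriv (Psi w) x (ln (1 + (w / x) ^+ 2)).
Proof.
move=> x0; have xn0 : x != 0 by rewrite gt_eqF.
derive => //=.
have := one_sqr_gt0 (w / x); move: (ln _) => l /gt_eqF/negbT h.
by field; rewrite xn0 /= gt_eqF// ltr_pwDl ?sqr_ge0 ?exprn_gt0.
Qed.

Lemma Psi_step w x : 0 < x -> Psi w (x + 1) - Psi w x <= ln (1 + (w / x) ^+ 2).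
Proof.
move=> x0; have [||c /andP[xc _] ->] := @MVT_has_deriv _ (Psi w)
  (fun y => ln (1 + (w / y) ^+ 2)) x (x + 1).
- by rewrite lerDl.
- by move=> y /andP[xy _]; apply: has_deriv_Psi; exact: lt_le_trans xy.
have c0 : 0 < c by exact: lt_le_trans xc.
rewrite addrAC subrr add0r mulr1 ler_ln ?posrE// lerD2l !expr_div_n.
rewrite ler_wpM2l ?sqr_ge0// lef_pV2 ?posrE ?exprn_gt0//.
by rewrite lerXn2r ?nnegrE ?(ltW x0) ?(ltW c0).
Qed.

(** The sum dominates the integral of the decreasing function
    ln (1 + (w / x)^2), of which [Psi w] is a primitive. *)
Lemma sum_ln_ge w n :
  Psi w (n%:R + 3) - Psi w 3 <= \sum_(i < n) ln (1 + (w / (i%:R + 3)) ^+ 2).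
Proof.
elim: n => [|n IH]; first by rewrite big_ord0 add0r subrr.
rewrite big_ord_recr /= -natr1.
have -> : n%:R + 1 + 3 = n%:R + 3 + 1 :> R by ring.
have := @Psi_step w (n%:R + 3); rewrite ltr_wpDl// => /(_ isT); lra.
Qed.

Lemma Psi_ge w x : 0 <= w -> 0 < x -> - (2 * w ^+ 2 / x) <= Psi w x.
Proof.
move=> w0 x0; rewrite /Psi.
have h1 : 0 <= x * ln (1 + (w / x) ^+ 2).
  by rewrite mulr_ge0 ?(ltW x0)// ln_ge0// lerDl sqr_ge0.
have h2 : atan (w / x) <= w / x.
  have z0 : 0 <= w / x by rewrite divr_ge0// ltW.
  rewrite -subr_ge0; pose f y : R := y - atan y.
  have : f 0 <= f (w / x).
    apply: (@has_deriv_nondecreasing _ f (fun y => 1 - (1 + y ^+ 2)^-1)) => // [y _|y _].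
      by derive.
    by rewrite subr_ge0 invf_le1// lerDl sqr_ge0.
  by rewrite /f atan0 subrr.
have h3 : 2 * w * atan (w / x) <= 2 * w * (w / x) by rewrite ler_wpM2l ?mulr_ge0.
have -> : 2 * w ^+ 2 / x = 2 * w * (w / x) by rewrite expr2 !mulrA.
lra.
Qed.

(** The logarithm of the infinite product over j >= 2 of 1 + (w / j)^2 is
    bounded below by its first term plus the integral from 3 to infinity, which
    is - Psi w 3.  Comparing with the integral from 2 to infinity instead would
    lose too much for the constant lambda0. *)
Lemma prod_decay Q w : 0 <= Q -> 0 <= w ->
  (forall n, Q * \prod_(i < n) (1 + (w / (i%:R + 2)) ^+ 2) <= 1) ->
  Q <= 4 * expR (- (2 * lambda0 R * w)).
Proof.
move=> Q0 w0 h; have [Qp|] := ltP 0 Q; last first.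
  by move=> Q_le0; apply: le_trans Q_le0 _; rewrite mulr_ge0 ?expR_ge0.
have hln n : ln Q + ln (1 + (w / 2) ^+ 2) + (- (2 * w ^+ 2 / (n%:R + 3)) - Psi w 3) <= 0.
  have pn m (k : R) : 0 < \prod_(i < m) (1 + (w / (i%:R + k)) ^+ 2).
    by apply: prodr_gt0 => i _.
  have prod_ln m : ln (\prod_(i < m) (1 + (w / (i%:R + 3)) ^+ 2)) =
      \sum_(i < m) ln (1 + (w / (i%:R + 3)) ^+ 2) :> R.
    elim: m => [|m IH]; first by rewrite !big_ord0 ln1.
    by rewrite !big_ord_recr /= lnM ?posrE ?pn ?IH.
  have := h n.+1; rewrite big_ord_recl /= add0r.
  under eq_bigr do rewrite /bump /= add1n -natr1 -addrA.
  have -> : 1 + 2 = 3 :> R by ring.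
  move=> H; have := ln_le0 H.
  rewrite lnM ?posrE ?mulr_gt0 ?pn// lnM ?posrE ?pn// prod_ln.
  have := sum_ln_ge w n; have := @Psi_ge w (n%:R + 3) w0.
  rewrite ltr_wpDl// => /(_ isT); lra.
have hlim : ln Q + ln (1 + (w / 2) ^+ 2) - Psi w 3 <= 0.
  rewrite leNgt; apply/negP; set e := _ - _ => e0.
  pose n := Num.truncn (2 * w ^+ 2 / e).
  have n1 : 2 * w ^+ 2 / e < n%:R + 1.
    by rewrite natr1; apply: truncnS_gt.
  have := hln n; rewrite -/e.
  have n3 : 0 < n%:R + 3 :> R by rewrite ltr_wpDl.
  have : 2 * w ^+ 2 / (n%:R + 3) < e.
    by rewrite ltr_pdivrMr// [e * _]mulrC -ltr_pdivrMr//; lra.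
  rewrite /e; lra.
have [z Ew] : exists z, w = 3 * z by exists (w / 3); field.
have z0 : 0 <= z by move: w0; rewrite Ew pmulr_rge0.
have key := ln_atan_ge z0.
have EPsi : Psi w 3 = 3 * ln (1 + z ^+ 2) - 6 * z * atan z.
  by rewrite /Psi Ew (_ : 3 * z / 3 = z); [ring|field].
have Eln : ln (1 + (w / 2) ^+ 2) = ln (4 + 9 * z ^+ 2) - ln 4.
  rewrite -ln_div ?posrE//; last by rewrite ltr_pwDl// mulr_ge0 ?sqr_ge0.
  by congr ln; rewrite Ew; field.
rewrite -[Q]lnK ?posrE// -[4 in X in _ <= X]lnK ?posrE// -expRD ler_expR.
rewrite Ew; move: hlim; rewrite Eln EPsi; lra.
Qed.
End ProductDecay.

(** * Integrals of continuous functions *)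

Section Primitives.
Local Open Scope classical_set_scope.
Context {R : realType}.
Implicit Types (f g : R -> R) (a b x : R).

Lemma has_deriv_near f g x d : (\forall y \near x, f y = g y) ->
  has_deriv f x d -> has_deriv g x d.
Proof.
move=> fg [df fd]; split; first exact: near_eq_derivable fg df.
by rewrite -fd; apply/esym/near_eq_derive.
Qed.

Lemma has_deriv0_eq f x y :
  (forall z, Num.min x y <= z <= Num.max x y -> has_deriv f z 0) -> f x = f y.
Proof.
wlog xy : x y / x <= y.
  move=> H; case: (leP x y) => [xy|/ltW yx] Df.
    by apply: H => // z; rewrite min_l// max_r//; exact: Df.
  by apply/esym/H => // z; rewrite min_l// max_r//; exact: Df.
rewrite min_l// max_r// => Df.
have [c _ /eqP] := MVT_has_deriv (df := fun=> 0) xy Df.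
by rewrite mul0r subr_eq0 => /eqP.
Qed.

Let primitive_from f a : continuous f ->
  exists F : R -> R, forall x, a < x -> has_deriv F x (f x).
Proof.
move=> cf; exists (fun x => \int[lebesgue_measure]_(t in `[a, x]) f t)%R => x ax.
have xx1 : x < x + 1 by rewrite ltrDl.
have int1 : lebesgue_measure.-integrable `[a, x + 1] (EFin \o f).
  apply: continuous_compact_integrable; first exact: segment_compact.
  exact: continuous_subspaceT.
have [dF Fx] := continuous_FTC1_closed xx1 int1 ax (cf x).
by split; [exact: dF|rewrite -derive1E Fx].
Qed.

(** Integrals with left end point - n, normalised to vanish at 0, agree on
    their common domain, so they glue to a primitive on the whole line. *)
Lemma primitive_exists f : continuous f ->
  exists F : R -> R, forall x, has_deriv F x (f x).
Proof.
move=> cf; have [G DG] := choice (fun n : nat => primitive_from (- n%:R) cf).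
pose H n x := G n x - G n 0.
have DH n x : - n%:R < x -> has_deriv (H n) x (f x).
  move=> nx; apply: has_deriv_eq.
    by apply: has_derivD; [exact: DG|exact: has_deriv_cst].
  by rewrite addr0.
have HE n m x : (0 < n)%N -> (n <= m)%N -> - n%:R < x -> H n x = H m x.
  move=> n0 nm nx; apply/eqP; rewrite -subr_eq0; apply/eqP.
  have <- : H n 0 - H m 0 = 0 by rewrite /H !subrr.
  apply: (@has_deriv0_eq (fun y => H n y - H m y)) => z /andP[z1 _].
  have nz : - n%:R < z.
    by apply: lt_le_trans z1; rewrite lt_min nx oppr_lt0 ltr0n.
  apply: has_deriv_eq.
    apply: has_derivD; first exact: DH nz.
    apply: has_derivN; apply: DH; apply: le_lt_trans nz.
    by rewrite lerN2 ler_nat.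
  by rewrite subrr.
pose N x := (Num.truncn `|x|).+1.
have Nx x : `|x| < (N x)%:R by exact: truncnS_gt.
exists (fun x => H (N x) x) => x.
apply: (@has_deriv_near (H (N x).+1)).
  near=> y; apply/esym/HE => //; last first.
    by have := Nx y; rewrite ltr_norml => /andP[].
  rewrite ltnS truncn_le_nat -natr1.
  have xy : `|x - y| < 1 by near: y; exact: nbhsx_ballx.
  have : `|y| <= `|x| + `|x - y|.
    by rewrite -{1}(subKr x y) ler_normB.
  by have := Nx x; lra.
apply: DH; apply: lt_trans (_ : - (N x)%:R < x); first by rewrite ltrN2 ltr_nat.
by have := Nx x; rewrite ltr_norml => /andP[].
Unshelve. all: by end_near.
Qed.

Definition primitive f : R -> R :=
  xget (fun=> 0) [set F | forall x, has_deriv F x (f x)].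

Lemma primitiveP f F x : (forall x, has_deriv F x (f x)) ->
  has_deriv (primitive f) x (f x).
Proof.
move=> DF; have h : exists G, [set G | forall x, has_deriv G x (f x)] G by exists F.
exact: (xgetPex (fun=> 0) h x).
Qed.

Lemma has_deriv_primitive f x : continuous f -> has_deriv (primitive f) x (f x).
Proof. by move=> /primitive_exists[F DF]; exact: (primitiveP x DF). Qed.

(** For continuous integrands, the oriented integral is the increment of a
    primitive; this turns linearity, translation, additivity on intervals and
    integration by parts into computations of derivatives. *)
Definition cint f a b : R := primitive f b - primitive f a.

Lemma cint_FTC f F a b : (forall x, has_deriv F x (f x)) ->
  cint f a b = F b - F a.
Proof.
move=> DF; suff /eqP : primitive f b - F b = primitive f a - F a.
  rewrite /cint subr_eq => /eqP ->; ring.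
apply: (@has_deriv0_eq (fun x => primitive f x - F x)) => x _.
apply: has_deriv_eq; first apply: has_derivD; last exact: subrr.
  exact: primitiveP DF.
exact: has_derivN.
Qed.

Lemma cint_cat f a b c : cint f a b + cint f b c = cint f a c.
Proof. by rewrite /cint; ring. Qed.

Lemma cintD f g a b : continuous f -> continuous g ->
  cint (fun x => f x + g x) a b = cint f a b + cint g a b.
Proof.
move=> cf cg; rewrite (cint_FTC (F := fun x => primitive f x + primitive g x)).
  by rewrite /cint; ring.
by move=> x; apply: has_derivD; exact: has_deriv_primitive.
Qed.

Lemma cintZ c f a b : continuous f ->
  cint (fun x => c * f x) a b = c * cint f a b.
Proof.
move=> cf; rewrite (cint_FTC (F := fun x => c * primitive f x)).
  by rewrite /cint; ring.
move=> x; apply: has_deriv_eq; first apply: has_derivM.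
- exact: has_deriv_cst.
- exact: has_deriv_primitive.
- by rewrite mul0r add0r.
Qed.

Lemma cint_lin3 c1 c2 c3 f1 f2 f3 a b :
  continuous f1 -> continuous f2 -> continuous f3 ->
  cint (fun x => c1 * f1 x + c2 * f2 x + c3 * f3 x) a b =
  c1 * cint f1 a b + c2 * cint f2 a b + c3 * cint f3 a b.
Proof.
move=> cf1 cf2 cf3; rewrite (cint_FTC (F := fun x =>
  c1 * primitive f1 x + c2 * primitive f2 x + c3 * primitive f3 x)).
  by rewrite /cint; ring.
move=> x; apply: has_deriv_eq.
  apply: has_derivD; first apply: has_derivD; apply: has_derivM;
  by [exact: has_deriv_cst|exact: has_deriv_primitive].
by rewrite /=; ring.
Qed.

Lemma cint_le f g a b : a <= b -> continuous f -> continuous g ->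
  (forall x, a <= x <= b -> f x <= g x) -> cint f a b <= cint g a b.
Proof.
move=> ab cf cg fg; rewrite /cint.
suff : primitive g a - primitive f a <= primitive g b - primitive f b by lra.
apply: (@has_deriv_nondecreasing _ (fun x => primitive g x - primitive f x)
  (fun x => g x - f x)) => [//|x _|x /fg]; last by rewrite subr_ge0.
by apply: has_derivD; [|apply: has_derivN]; exact: has_deriv_primitive.
Qed.

Lemma cint_cst c a b : cint (fun=> c) a b = c * (b - a).
Proof.
rewrite (cint_FTC (F := fun x => c * x)); first by ring.
by move=> x; derive; rewrite /=; ring.
Qed.

Lemma cint_norm_le f g a b : a <= b -> continuous f -> continuous g ->
  (forall x, a <= x <= b -> `|f x| <= g x) -> `|cint f a b| <= cint g a b.
Proof.
move=> ab cf cg fg; rewrite ler_norml; apply/andP; split; last first.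
  by apply: cint_le => // x /fg; rewrite ler_norml => /andP[].
rewrite lerNl -mulN1r -cintZ//.
apply: cint_le => // [x|x /fg]; last first.
  by rewrite ler_norml mulN1r lerNl => /andP[].
by apply: cvgM; [exact: cvg_cst|exact: cf].
Qed.

Lemma cint_shift f c a b : continuous f ->
  cint (fun x => f (x + c)) a b = cint f (a + c) (b + c).
Proof.
move=> cf; rewrite (cint_FTC (F := fun x => primitive f (x + c)))//.
move=> x; apply: has_deriv_eq.
  apply: has_deriv_comp; first exact: has_deriv_primitive.
  by apply: has_derivD; [exact: has_deriv_id|exact: has_deriv_cst].
by rewrite addr0 mulr1.
Qed.

Lemma cint_odd f a : continuous f -> (forall x, f (- x) = - f x) ->
  cint f (- a) a = 0.
Proof.
move=> cf oddf; rewrite /cint.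
have : primitive f a - primitive f (- a) = primitive f 0 - primitive f (- 0).
  apply: (@has_deriv0_eq (fun x => primitive f x - primitive f (- x))) => x _.
  apply: has_deriv_eq; first apply: has_derivD.
  - exact: has_deriv_primitive.
  - apply: has_derivN; apply: has_deriv_comp; first exact: has_deriv_primitive.
    by apply: has_derivN; exact: has_deriv_id.
  - by rewrite oddf; ring.
by rewrite oppr0 subrr.
Qed.

End Primitives.

(** * The Gamma integral on vertical lines *)

(** With w = sigma * exp x, this is w^s * exp (- w), the integrand of the Gamma
    function at [s] in the variable x. *)
Definition gker (R : realType) (sigma : R) (s : nat) (x : R) : R :=
  (sigma * expR x) ^+ s * expR (- (sigma * expR x)).

(** Half the total length of the 2 M + 1 cells of length [h] centred at the
    multiples j h with |j| <= M. *)
Definition halfwidth (R : realType) (h : R) (M : nat) : R := (M%:R + 2^-1) * h.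

Section GammaKernel.
Context {R : realType} (sigma : R) (sigma_gt0 : 0 < sigma).
Implicit Types (x w : R) (s : nat).

Lemma gker_ge0 s x : 0 <= gker sigma s x.
Proof. by rewrite mulr_ge0 ?expR_ge0// exprn_ge0// mulr_ge0 ?expR_ge0// ltW. Qed.

Lemma has_deriv_gker s x :
  has_deriv (gker sigma s) x (s%:R * gker sigma s x - gker sigma s.+1 x).
Proof.
rewrite /gker; apply: has_deriv_eq.
  apply: has_derivM.
    apply: has_derivX; apply: has_derivM; first exact: has_deriv_cst.
    exact: has_deriv_expR.
  apply: has_deriv_comp; first exact: has_deriv_expR.
  apply: has_derivN; apply: has_derivM; first exact: has_deriv_cst.
  exact: has_deriv_expR.
case: s => [|s] /=; last by rewrite !exprS; ring.
by rewrite !mul0r expr1 expr0; ring.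
Qed.

Lemma exp_decay (w : R) n : 0 <= w -> w ^+ n * expR (- w) <= n`!%:R.
Proof.
move=> w0; rewrite expRN ler_pdivrMr ?expR_gt0//.
case: n => [|n]; first by rewrite expr0 fact0 mul1r -expR0 ler_expR.
have := expR_ge1Dxn n w0; rewrite addrC => h.
rewrite mulrC -ler_pdivrMr ?ltr0n ?fact_gt0//.
by apply: le_trans h; rewrite lerDl.
Qed.

Lemma gker_le s x : gker sigma s.+1 x <=
  (s`!%:R * sigma + s.+2`!%:R / sigma) * expR (- `|x|).
Proof.
have w0 : 0 < sigma * expR x by rewrite mulr_gt0 ?expR_gt0.
have fact_ge0 n : 0 <= n`!%:R :> R by rewrite ler0n.
case: (ltrP x 0) => x0; last first.
- apply: le_trans (_ : s.+2`!%:R / sigma * expR (- x) <= _); last first.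
    by rewrite ger0_norm// ler_wpM2r ?expR_ge0// lerDr mulr_ge0// ltW.
  have := exp_decay s.+2 (ltW w0); rewrite exprS -mulrA -/(gker sigma s.+1 x).
  rewrite -ler_pdivlMl// => /le_trans; apply.
  by rewrite expRN invfM mulrC mulrA.
- apply: le_trans (_ : s`!%:R * sigma * expR x <= _); last first.
    by rewrite ltr0_norm// opprK ler_wpM2r ?expR_ge0// lerDl mulr_ge0 ?invr_ge0// ltW.
  by rewrite /gker exprS -mulrA -[leRHS]mulrA [leRHS]mulrC ler_pM2l// exp_decay// ltW.
Qed.

End GammaKernel.

Section Halfwidth.
Local Open Scope classical_set_scope.
Context {R : realType} (h : R) (h_gt0 : 0 < h).

Lemma halfwidth_gt0 M : 0 < halfwidth h M.
Proof. by rewrite mulr_gt0// ltr_wpDl. Qed.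

Lemma halfwidth_le M N : (M <= N)%N -> halfwidth h M <= halfwidth h N.
Proof. by move=> MN; rewrite ler_wpM2r ?(ltW h_gt0)// lerD2r ler_nat. Qed.

Lemma cvg_expR_halfwidth : expR (- halfwidth h M) @[M --> \oo] --> (0 : R).
Proof.
have -> : (fun M => expR (- halfwidth h M)) =
    geometric (expR (- (2^-1 * h))) (expR (- h)).
  apply/funext => M /=; rewrite -expRM_natl -expRD; congr expR.
  by rewrite /halfwidth; ring.
by apply: cvg_geometric; rewrite ger0_norm ?expR_ge0// expR_lt1 oppr_lt0.
Qed.

Lemma cvg_gker_halfwidth sigma s (x : nat -> R) : 0 < sigma ->
  (forall M, `|x M| = halfwidth h M) ->
  gker sigma s.+1 (x M) @[M --> \oo] --> (0 : R).
Proof.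
move=> sigma0 xM; set K := s`!%:R * sigma + s.+2`!%:R / sigma.
apply: (squeeze_cvgr (f := fun=> 0) (h := fun M => K * expR (- halfwidth h M))).
- by near=> M; rewrite gker_ge0//= -xM gker_le.
- exact: cvg_cst.
- by rewrite -(mulr0 K); apply: cvgM; [exact: cvg_cst|exact: cvg_expR_halfwidth].
Unshelve. all: by end_near. Qed.

End Halfwidth.

Section GammaTransform.
Local Open Scope classical_set_scope.
Context {R : realType} (sigma h : R) (sigma_gt0 : 0 < sigma) (h_gt0 : 0 < h).
Implicit Types (w x : R) (s M n : nat).
Let T := halfwidth h.

(** The integral of gker sigma s x * exp (i w x) over the line is
    sigma^(- i w) Gamma(s + i w).  Truncated to a symmetric interval, its real
    and imaginary parts are [gcos] and [gsin]; [gmass] is the case w = 0. *)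
Definition gmass s M := cint (gker sigma s) (- T M) (T M).
Definition gcos s w M :=
  cint (fun x => gker sigma s x * cos (w * x)) (- T M) (T M).
Definition gsin s w M :=
  cint (fun x => gker sigma s x * sin (w * x)) (- T M) (T M).

Let T_gt0 M : 0 < T M. Proof. exact: halfwidth_gt0. Qed.
Let NT_le_T M : - T M <= T M. Proof. by rewrite ge0_cp ?ltW. Qed.

Lemma continuous_gker s : continuous (gker sigma s).
Proof. by move=> x; apply: has_deriv_continuous (has_deriv_gker _ _ _). Qed.

Lemma has_deriv_cosM w x : has_deriv (fun x => cos (w * x)) x (- w * sin (w * x)).
Proof. by derive; rewrite /=; ring. Qed.

Lemma has_deriv_sinM w x : has_deriv (fun x => sin (w * x)) x (w * cos (w * x)).
Proof. by derive; rewrite /=; ring. Qed.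

Lemma continuous_gker_cos s w : continuous (fun x => gker sigma s x * cos (w * x)).
Proof.
move=> x; apply: has_deriv_continuous.
by apply: has_derivM; [exact: has_deriv_gker|exact: has_deriv_cosM].
Qed.

Lemma continuous_gker_sin s w : continuous (fun x => gker sigma s x * sin (w * x)).
Proof.
move=> x; apply: has_deriv_continuous.
by apply: has_derivM; [exact: has_deriv_gker|exact: has_deriv_sinM].
Qed.

(** Integration by parts; these are the real and imaginary parts of
    Gamma (z + 1) = z Gamma (z), up to boundary terms. *)
Lemma gcosS s w M : gcos s.+1 w M = s%:R * gcos s w M - w * gsin s w M
  - (gker sigma s (T M) * cos (w * T M) - gker sigma s (- T M) * cos (w * - T M)).
Proof.
rewrite -(cint_FTC (f := fun x => s%:R * (gker sigma s x * cos (w * x)) +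
   -1 * (gker sigma s.+1 x * cos (w * x)) + - w * (gker sigma s x * sin (w * x)))
   (F := fun x => gker sigma s x * cos (w * x))); last first.
  move=> x; apply: has_deriv_eq.
    by apply: has_derivM; [exact: has_deriv_gker|exact: has_deriv_cosM].
  by rewrite /=; ring.
have cc := continuous_gker_cos; have cs := continuous_gker_sin.
by rewrite cint_lin3// /gcos /gsin; ring.
Qed.

Lemma gsinS s w M : gsin s.+1 w M = s%:R * gsin s w M + w * gcos s w M
  - (gker sigma s (T M) * sin (w * T M) - gker sigma s (- T M) * sin (w * - T M)).
Proof.
rewrite -(cint_FTC (f := fun x => s%:R * (gker sigma s x * sin (w * x)) +
   -1 * (gker sigma s.+1 x * sin (w * x)) + w * (gker sigma s x * cos (w * x)))
   (F := fun x => gker sigma s x * sin (w * x))); last first.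
  move=> x; apply: has_deriv_eq.
    by apply: has_derivM; [exact: has_deriv_gker|exact: has_deriv_sinM].
  by rewrite /=; ring.
have cc := continuous_gker_cos; have cs := continuous_gker_sin.
by rewrite cint_lin3// /gcos /gsin; ring.
Qed.

Lemma gcos0 s M : gcos s 0 M = gmass s M.
Proof.
by congr cint; apply/funext => x; rewrite mul0r cos0 mulr1.
Qed.

Let cvg_boundary s (u : R -> R) : (forall x, `|u x| <= 1) ->
  gker sigma s.+1 (T M) * u (T M) - gker sigma s.+1 (- T M) * u (- T M)
    @[M --> \oo] --> (0 : R).
Proof.
move=> u1; have bnd (x : nat -> R) : (forall M, `|x M| = T M) ->
    gker sigma s.+1 (x M) * u (x M) @[M --> \oo] --> (0 : R).
  move=> xT; have c0 := @cvg_gker_halfwidth _ _ h_gt0 _ s _ sigma_gt0 xT.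
  apply: (squeeze_cvgr (f := fun M => - gker sigma s.+1 (x M))
    (h := fun M => gker sigma s.+1 (x M))) => //; last by rewrite -oppr0; exact: cvgN.
  near=> M; rewrite -ler_norml normrM ger0_norm ?gker_ge0//.
  by rewrite ler_piMr ?gker_ge0.
have cT := bnd T (fun M => gtr0_norm (T_gt0 M)).
have cN := bnd (fun M => - T M) (fun M => etrans (normrN _) (gtr0_norm (T_gt0 M))).
have c := cvgB cT cN; rewrite subr0 in c; exact: c.
Unshelve. all: by end_near. Qed.

Lemma cvg_gmass n : gmass n.+1 M @[M --> \oo] --> (n`!%:R : R).
Proof.
elim: n => [|n IH].
- have E M : gmass 1 M = gker sigma 0 (- T M) - gker sigma 0 (T M).
    rewrite /gmass (cint_FTC (F := fun x => - gker sigma 0 x)); first by ring.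
    move=> x; apply: has_deriv_eq; first by apply: has_derivN; exact: has_deriv_gker.
    by rewrite /=; ring.
  under eq_fun do rewrite E.
  have K0 x : gker sigma 0 x = expR (- (sigma * expR x)).
    by rewrite /gker expr0 mul1r.
  have cE := cvg_expR_halfwidth h_gt0.
  rewrite (_ : 0`!%:R = 1 - 0 :> R); last by rewrite fact0 subr0.
  apply: cvgB; last first.
    apply: (squeeze_cvgr (f := fun=> 0) (h := fun M => sigma^-1 * expR (- T M))).
    + near=> M; rewrite gker_ge0//= K0 expRN expRN -invfM.
      by rewrite lef_pV2 ?posrE ?mulr_gt0 ?expR_gt0// (le_trans _ (expR_ge1Dx _))// lerDr.
    + exact: cvg_cst.
    + by rewrite -(mulr0 sigma^-1); apply: cvgM; [exact: cvg_cst|exact: cE].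
  under eq_fun do rewrite K0.
  rewrite -expR0; apply: continuous_cvg; first exact: continuous_expR.
  rewrite -oppr0; apply: cvgN.
  by rewrite -(mulr0 sigma); apply: cvgM; [exact: cvg_cst|exact: cE].
- have E M : gmass n.+2 M = n.+1%:R * gmass n.+1 M
      - (gker sigma n.+1 (T M) * 1 - gker sigma n.+1 (- T M) * 1).
    by rewrite -!gcos0 gcosS !mul0r cos0 subr0.
  under eq_fun do rewrite E.
  rewrite (_ : n.+1`!%:R = n.+1%:R * n`!%:R - 0 :> R); last by rewrite factS natrM subr0.
  apply: cvgB.
    by apply: cvgM; [exact: cvg_cst|exact: IH].
  by apply: (@cvg_boundary n (fun=> 1)) => x; rewrite normr1.
Unshelve. all: by end_near. Qed.

Let cint_nd (f : R -> R) : continuous f -> (forall x, 0 <= f x) ->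
  nondecreasing_seq (fun M => cint f (- T M) (T M)).
Proof.
move=> cf f0 M N MN; have TMN : T M <= T N by exact: halfwidth_le.
have i0 a b : a <= b -> 0 <= cint f a b.
  move=> ab; rewrite -(mul0r (b - a)) -cint_cst.
  by apply: cint_le => //; exact: cst_continuous.
rewrite -[leRHS](@cint_cat _ f _ (- T M)) -(@cint_cat _ f (- T M) (T M) (T N)).
by have := i0 _ _ TMN; have := i0 (- T N) (- T M); rewrite lerN2 => /(_ TMN); lra.
Qed.

Lemma gmass_le n M : gmass n.+1 M <= n`!%:R.
Proof.
have nd := cint_nd (@continuous_gker n.+1) (gker_ge0 sigma_gt0 n.+1).
have c := @cvg_gmass n.
rewrite -(cvg_lim _ c)//; apply: (nondecreasing_cvgn_le nd).
by apply: cvgP c.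
Qed.

Lemma gmass_ge0 s M : 0 <= gmass s M.
Proof.
rewrite -(mul0r (T M - - T M)) -cint_cst.
apply: cint_le => // [||x _]; [exact: cst_continuous|exact: continuous_gker|].
exact: gker_ge0.
Qed.

(** With X and Y the two integrals, X^2 + Y^2 is the integral of the kernel times
    X cos (w x) + Y sin (w x), which is at most the square root of X^2 + Y^2. *)
Lemma gcos2Dgsin2_le s w M : gcos s w M ^+ 2 + gsin s w M ^+ 2 <= gmass s M ^+ 2.
Proof.
set X := gcos s w M; set Y := gsin s w M.
have m0 := gmass_ge0 s M.
pose r := Num.sqrt (X ^+ 2 + Y ^+ 2).
have r0 : 0 <= r by exact: sqrtr_ge0.
have r2 : r ^+ 2 = X ^+ 2 + Y ^+ 2 by rewrite sqr_sqrtr// addr_ge0 ?sqr_ge0.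
suff : r ^+ 2 <= r * gmass s M.
  rewrite -r2; have [->|rn0] := eqVneq r 0; first by rewrite expr0n/= sqr_ge0.
  by rewrite expr2 ler_pM2l ?lt_def ?rn0// => ?; rewrite -expr2 ler_sqr ?nnegrE.
have -> : r ^+ 2 = cint (fun x => X * (gker sigma s x * cos (w * x)) +
    Y * (gker sigma s x * sin (w * x)) + 0 * gker sigma s x) (- T M) (T M).
  rewrite cint_lin3 ?r2; first by rewrite /X /Y /gcos /gsin; ring.
  - exact: continuous_gker_cos.
  - exact: continuous_gker_sin.
  - exact: continuous_gker.
rewrite /gmass -cintZ; last exact: continuous_gker.
apply: cint_le => // [||x _].
- move=> x; apply: has_deriv_continuous; apply: has_derivD; first apply: has_derivD.
  + apply: has_derivM; first exact: has_deriv_cst.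
    by apply: has_derivM; [exact: has_deriv_gker|exact: has_deriv_cosM].
  + apply: has_derivM; first exact: has_deriv_cst.
    by apply: has_derivM; [exact: has_deriv_gker|exact: has_deriv_sinM].
  + by apply: has_derivM; [exact: has_deriv_cst|exact: has_deriv_gker].
- move=> x; apply: has_deriv_continuous.
  by apply: has_derivM; [exact: has_deriv_cst|exact: has_deriv_gker].
- have h1 : X * cos (w * x) + Y * sin (w * x) <= r.
    apply: le_trans (ler_norm _) _; rewrite -ler_sqr ?nnegrE// real_normK ?num_real// r2.
    have := cos2Dsin2 (w * x); have := sqr_ge0 (X * sin (w * x) - Y * cos (w * x)).
    by nra.
  have := ler_wpM2r (gker_ge0 sigma_gt0 s x) h1; lra.
Qed.

(** Adding the convergent [gmass] to the oscillating integral makes it monotone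
    in [M]. *)
Let is_cvg_cint_gker n (u : R -> R) : continuous u -> (forall x, `|u x| <= 1) ->
  cvgn (fun M => cint (fun x => gker sigma n.+1 x * u x) (- T M) (T M)).
Proof.
move=> cu u1; have cg := @continuous_gker n.+1.
have cgu : continuous (fun x => gker sigma n.+1 x * u x).
  by move=> x; apply: cvgM; [exact: cg|exact: cu].
have cs : continuous (fun x => gker sigma n.+1 x + gker sigma n.+1 x * u x).
  by move=> x; apply: cvgD; [exact: cg|exact: cgu].
have bnd x : `|gker sigma n.+1 x * u x| <= gker sigma n.+1 x.
  by rewrite normrM ger0_norm ?gker_ge0// ler_piMr ?gker_ge0.
have nd := cint_nd cs; have := @cvg_gmass n => cm.
have E : (fun M => cint (fun x => gker sigma n.+1 x * u x) (- T M) (T M)) =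
  (fun M => cint (fun x => gker sigma n.+1 x + gker sigma n.+1 x * u x) (- T M) (T M)
     - gmass n.+1 M).
  by apply/funext => M; rewrite cintD// /gmass; ring.
rewrite E; apply: is_cvgB; last exact: cvgP cm.
apply: nondecreasing_is_cvgn.
  by apply: nd => x; have := bnd x; rewrite ler_norml -subr_ge0 opprK addrC => /andP[].
exists (2 * n`!%:R) => _ [M _ <-].
rewrite cintD//; have := gmass_le n M.
have : cint (fun x => gker sigma n.+1 x * u x) (- T M) (T M) <= gmass n.+1 M.
  by apply: cint_le => // x _; have := bnd x; rewrite ler_norml => /andP[].
by rewrite /gmass; lra.
Qed.

Let scaled_continuous (w : R) (f : R -> R) : continuous f ->
  continuous (fun x => f (w * x)).
Proof.
move=> cf x; apply: (@continuous_comp _ _ _ (fun x => w * x) f); last exact: cf.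
by apply: cvgM; [exact: cvg_cst|exact: cvg_id].
Qed.

(** The squared modulus Q of Gamma(2 + i w) satisfies
    Q * prod_(2 <= j <= n + 1) (j^2 + w^2) = |Gamma(n + 2 + i w)|^2
    <= Gamma(n + 2)^2, which is the hypothesis of [prod_decay]. *)
Lemma gcos_decay w : 0 <= w ->
  exists2 X, gcos 2 w M @[M --> \oo] --> X & `|X| <= 2 * expR (- (lambda0 R * w)).
Proof.
move=> w0.
pose X n : R := limn (gcos n.+1 w); pose Y n : R := limn (gsin n.+1 w).
have cX n : gcos n.+1 w M @[M --> \oo] --> X n.
  by have := @is_cvg_cint_gker n (fun x => cos (w * x))
    (@scaled_continuous w _ (@continuous_cos R)) (fun x => cos_max _).
have cY n : gsin n.+1 w M @[M --> \oo] --> Y n.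
  by have := @is_cvg_cint_gker n (fun x => sin (w * x))
    (@scaled_continuous w _ (@continuous_sin R)) (fun x => sin_max _).
have XS n : X n.+1 = n.+1%:R * X n - w * Y n.
  rewrite {1}/X; apply: cvg_lim => //.
  rewrite (eq_cvg _ _ (gcosS n.+1 w)).
  have := @cvg_boundary n (fun x => cos (w * x)) (fun x => cos_max _) => cb.
  rewrite -[n.+1%:R * X n - w * Y n]subr0; apply: cvgB; last exact: cb.
  by apply: cvgB; apply: cvgM; [exact: cvg_cst|exact: cX|exact: cvg_cst|exact: cY].
have YS n : Y n.+1 = n.+1%:R * Y n + w * X n.
  rewrite {1}/Y; apply: cvg_lim => //.
  rewrite (eq_cvg _ _ (gsinS n.+1 w)).
  have := @cvg_boundary n (fun x => sin (w * x)) (fun x => sin_max _) => cb.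
  rewrite -[n.+1%:R * Y n + w * X n]subr0; apply: cvgB; last exact: cb.
  by apply: cvgD; apply: cvgM; [exact: cvg_cst|exact: cY|exact: cvg_cst|exact: cX].
have XY_le n : X n ^+ 2 + Y n ^+ 2 <= n`!%:R ^+ 2.
  have c : gcos n.+1 w M ^+ 2 + gsin n.+1 w M ^+ 2 @[M --> \oo] --> X n ^+ 2 + Y n ^+ 2.
    by apply: cvgD; apply: cvgM; [exact: cX|exact: cX|exact: cY|exact: cY].
  rewrite -(cvg_lim _ c)//; apply: limr_le; first exact: cvgP c.
  near=> M; apply: le_trans (gcos2Dgsin2_le _ _ _) _.
  by rewrite ler_sqr ?nnegrE ?gmass_le ?gmass_ge0.
have XY_prod n : (X 1 ^+ 2 + Y 1 ^+ 2) *
    \prod_(i < n) (1 + (w / (i%:R + 2)) ^+ 2) * n.+1`!%:R ^+ 2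
    = X n.+1 ^+ 2 + Y n.+1 ^+ 2.
  elim: n => [|n IH]; first by rewrite big_ord0 factS fact0 expr1n !mulr1.
  rewrite big_ord_recr/= (XS n.+1) (YS n.+1) factS natrM.
  have -> : n%:R + 2 = n.+2%:R :> R by rewrite -!natr1; ring.
  have n2 : n.+2%:R != 0 :> R by rewrite pnatr_eq0.
  transitivity ((n.+2%:R ^+ 2 + w ^+ 2) * (X n.+1 ^+ 2 + Y n.+1 ^+ 2)); last by ring.
  by rewrite -IH; field.
exists (X 1); first exact: cX.
have Q0 : 0 <= X 1 ^+ 2 + Y 1 ^+ 2 by rewrite addr_ge0 ?sqr_ge0.
have Q_le : X 1 ^+ 2 + Y 1 ^+ 2 <= 4 * expR (- (2 * lambda0 R * w)).
  apply: prod_decay => // n.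
  have f0 : 0 < n.+1`!%:R ^+ 2 :> R by rewrite exprn_gt0// ltr0n fact_gt0.
  by rewrite -(ler_pM2r f0) XY_prod mul1r.
rewrite -ler_sqr ?nnegrE ?mulr_ge0 ?expR_ge0// real_normK ?num_real//.
apply: le_trans (_ : X 1 ^+ 2 + Y 1 ^+ 2 <= _); first by rewrite lerDl sqr_ge0.
apply: le_trans Q_le _; rewrite exprMn -expRM_natl.
rewrite le_eqVlt; apply/orP; left; apply/eqP; congr (_ * expR _); ring.
Unshelve. all: by end_near. Qed.

End GammaTransform.

(** * The Fejer kernel *)

Section Fejer.
Local Open Scope classical_set_scope.
Context {R : realType}.
Implicit Types (w x z : R) (n : nat).

(** Not normalised: the mean values of these two kernels over a period are 1
    and [n]. *)
Definition dirichlet w n x : R := 1 + 2 * \sum_(k < n) cos (k.+1%:R * w * x).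
Definition fejer w n x : R := \sum_(i < n) dirichlet w i x.

Lemma sin_dirichlet w n x :
  sin (w * x / 2) * dirichlet w n x = sin ((n%:R + 2^-1) * (w * x)).
Proof.
rewrite /dirichlet; elim: n => [|n IH].
  by rewrite big_ord0 mulr0 addr0 mulr1 add0r mulrC.
rewrite big_ord_recr/= -(natr1 n); set S := \sum_(k < n) _ in IH *.
rewrite (_ : _ * _ = sin (w * x / 2) * (1 + 2 * S)
  + 2 * sin (w * x / 2) * cos ((n%:R + 1) * w * x)); last by ring.
rewrite IH.
have -> : (n%:R + 2^-1) * (w * x) = (n%:R + 1) * w * x - w * x / 2 by field.
have -> : (n%:R + 1 + 2^-1) * (w * x) = (n%:R + 1) * w * x + w * x / 2 by field.
by rewrite sinB sinD; ring.
Qed.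

Lemma sin2_fejer w n x :
  sin (w * x / 2) ^+ 2 * fejer w n x = sin (n%:R * (w * x / 2)) ^+ 2.
Proof.
rewrite /fejer; elim: n => [|n IH].
  by rewrite big_ord0 mulr0 mul0r sin0 expr0n.
rewrite big_ord_recr/= mulrDr IH [in X in _ + X]expr2 -[X in _ + X]mulrA sin_dirichlet -(natr1 n).
set u := w * x / 2; set v := n%:R * u.
have -> : (n%:R + 2^-1) * (w * x) = v + (v + u) by rewrite /v /u; field.
have -> : (n%:R + 1) * u = v + u by rewrite /v; ring.
rewrite !sinD !cosD.
have c v' : cos v' ^+ 2 = 1 - sin v' ^+ 2 :> R by exact: cos2sin2.
transitivity (sin v ^+ 2 + (sin u ^+ 2 * (cos v ^+ 2 - sin v ^+ 2)
  + 2 * sin v * cos v * sin u * cos u)); first by ring.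
rewrite sqrrD !exprMn !c; ring.
Qed.

Lemma sin2_fejer_le w n x : sin (w * x / 2) ^+ 2 * `|fejer w n x| <= 1.
Proof.
rewrite -{1}(ger0_norm (sqr_ge0 (sin (w * x / 2)))) -normrM sin2_fejer normrX.
by rewrite exprn_ile1 ?sin_max.
Qed.

Lemma fejerN w n x : fejer w n (- x) = fejer w n x.
Proof.
apply: eq_bigr => i _; congr (1 + 2 * _); apply: eq_bigr => k _.
by rewrite mulrN cosN.
Qed.

Lemma cos_periodZ (k : int) x : cos (x + k%:~R * (2 * pi)) = cos x.
Proof.
have nat_case (m : nat) (y : R) : cos (y + m%:R * (2 * pi)) = cos y.
  elim: m y => [|m IH] y; first by rewrite mul0r addr0.
  by rewrite -(natr1 m) mulrDl mul1r addrA [in X in _ + X]mulr_natl cosD2pi IH.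
case: k => m; first exact: nat_case.
by rewrite NegzE mulrNz -pmulrn mulNr -(nat_case m.+1 (x - _)) subrK.
Qed.

Lemma fejer_period (h : R) n (j : int) x : h != 0 ->
  fejer (2 * pi / h) n (x + j%:~R * h) = fejer (2 * pi / h) n x.
Proof.
move=> h0; apply: eq_bigr => i _; congr (1 + 2 * _); apply: eq_bigr => k _.
rewrite -[RHS](cos_periodZ (k.+1%:Z * j)%R); congr cos.
by rewrite intrM; field.
Qed.

Lemma continuous_sumf (f : nat -> R -> R) n : (forall i, continuous (f i)) ->
  continuous (fun x => \sum_(i < n) f i x).
Proof.
move=> cf; elim: n => [|n IH].
  have -> : (fun x => \sum_(i < 0) f i x) = cst 0.
    by apply/funext => x; rewrite big_ord0.
  exact: cst_continuous.
have -> : (fun x => \sum_(i < n.+1) f i x) = (fun x => \sum_(i < n) f i x + f n x).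
  by apply/funext => x; rewrite big_ord_recr.
by move=> x; apply: cvgD; [exact: IH|exact: cf].
Qed.

Lemma continuous_cosM w : continuous (fun x => cos (w * x)).
Proof. by move=> x; apply: has_deriv_continuous (has_deriv_cosM w x). Qed.

Lemma continuous_dirichlet w n : continuous (dirichlet w n).
Proof.
move=> x; apply: cvgD; first exact: cvg_cst.
apply: cvgM; first exact: cvg_cst.
apply: (@continuous_sumf (fun k x => cos (k.+1%:R * w * x)) n) => k.
exact: continuous_cosM.
Qed.

Lemma continuous_fejer w n : continuous (fejer w n).
Proof.
by apply: (@continuous_sumf (fun i => dirichlet w i)) => i; exact: continuous_dirichlet.
Qed.

Lemma cint_sum (f : nat -> R -> R) n a b : (forall i, continuous (f i)) ->
  cint (fun x => \sum_(i < n) f i x) a b = \sum_(i < n) cint (f i) a b.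
Proof.
move=> cf; rewrite (cint_FTC (F := fun x => \sum_(i < n) primitive (f i) x)).
  by rewrite -sumrB.
move=> x; elim: n => [|n IH].
  have -> : (fun x => \sum_(i < 0) primitive (f i) x) = (fun=> 0).
    by apply/funext => y; rewrite big_ord0.
  by rewrite big_ord0; exact: has_deriv_cst.
have -> : (fun x => \sum_(i < n.+1) primitive (f i) x) =
    (fun x => \sum_(i < n) primitive (f i) x + primitive (f n) x).
  by apply/funext => y; rewrite big_ord_recr.
by rewrite big_ord_recr; apply: has_derivD; [exact: IH|exact: has_deriv_primitive].
Qed.

Lemma cint_mul_dirichlet (f : R -> R) w n a b : continuous f ->
  cint (fun x => f x * dirichlet w n x) a b =
  cint f a b + 2 * \sum_(k < n) cint (fun x => f x * cos (k.+1%:R * w * x)) a b.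
Proof.
move=> cf.
have cc (k : nat) : continuous (fun x => f x * cos (k.+1%:R * w * x)).
  by move=> x; apply: cvgM; [exact: cf|exact: continuous_cosM].
have cS := @continuous_sumf _ n cc.
rewrite -(@cint_sum _ n a b cc) -cintZ// -cintD//.
  congr cint; apply/funext => x; rewrite /dirichlet -mulr_sumr; ring.
by move=> x; apply: cvgM; [exact: cvg_cst|exact: cS].
Qed.

Lemma cint_mul_fejer (f : R -> R) w n a b : continuous f ->
  cint (fun x => f x * fejer w n x) a b =
  \sum_(i < n) cint (fun x => f x * dirichlet w i x) a b.
Proof.
move=> cf; rewrite -(cint_sum (f := fun i x => f x * dirichlet w i x)).
  by congr cint; apply/funext => x; rewrite mulr_sumr.
by move=> i x; apply: cvgM; [exact: cf|exact: continuous_dirichlet].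
Qed.

Lemma cint_fejer h n : 0 < h ->
  cint (fejer (2 * pi / h) n) (- (h / 2)) (h / 2) = n%:R * h.
Proof.
move=> h0; have hn0 : h != 0 by rewrite gt_eqF.
have c1 : continuous (fun _ : R => 1 : R) by move=> x; exact: cvg_cst.
have -> : fejer (2 * pi / h) n = (fun x => 1 * fejer (2 * pi / h) n x).
  by apply/funext => x; rewrite mul1r.
rewrite (cint_mul_fejer _ _ _ _ c1).
rewrite (eq_bigr (fun=> h)) => [|i _]; first by rewrite sumr_const card_ord mulr_natl.
rewrite (cint_mul_dirichlet _ _ _ _ c1) cint_cst big1 => [|k _]; first by field.
have w0 : k.+1%:R * (2 * pi / h) != 0.
  by rewrite !mulf_neq0 ?pnatr_eq0 ?invr_eq0 ?gt_eqF ?pi_gt0.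
rewrite (cint_FTC (F := fun x => sin (k.+1%:R * (2 * pi / h) * x) /
   (k.+1%:R * (2 * pi / h)))).
  have sin_natpi m : sin (m%:R * pi) = 0 :> R.
    elim: m => [|m IH]; first by rewrite mul0r sin0.
    by rewrite -(natr1 m) mulrDl mul1r sinDpi IH oppr0.
  by rewrite mulrN sinN (_ : _ * (h / 2) = k.+1%:R * pi) ?sin_natpi ?oppr0 ?subrr//; field.
move=> x; apply: has_deriv_eq.
  apply: has_derivM; last exact: has_deriv_cst.
  exact: has_deriv_sinM.
by rewrite /= mul1r mulr0 addr0 mulrAC divff// mul1r.
Qed.

End Fejer.

(** * Comparison of the sum with the integral *)

Section Cells.
Local Open Scope classical_set_scope.
Context {R : realType}.

(** With t = z / 2, sin t >= t cos t gives sin z = 2 sin t cos t >= z cos^2 t,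
    and cos^2 t >= 1/2. *)
Lemma half_le_sin (z : R) : 0 <= z <= pi / 2 -> z / 2 <= sin z.
Proof.
move=> /andP[z0 zpi]; pose t := z / 2.
have pi0 := @pi_gt0 R.
have zt : z = t *+ 2 by rewrite -mulr_natr /t; field.
have tan_ge : t * cos t <= sin t.
  rewrite -subr_ge0; pose f (y : R) := sin y - y * cos y.
  have f0 : f 0 = 0 by rewrite /f sin0 mul0r subr0.
  rewrite -/(f t) -f0; apply: (@has_deriv_nondecreasing _ f (fun y => y * sin y)).
  - by rewrite divr_ge0.
  - by move=> y _; derive; rewrite /=; ring.
  - move=> y /andP[y0 yt]; rewrite mulr_ge0// sin_ge0_pi// y0/=.
    by apply: le_trans yt _; rewrite /t; lra.
have cz : 0 <= cos z by apply: cos_ge0_pihalf; apply/andP; split; lra.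
have ct : 0 <= cos t by apply: cos_ge0_pihalf; apply/andP; split; rewrite /t; lra.
have c2 : cos t ^+ 2 = (1 + cos z) / 2.
  by rewrite zt cos_mulr2n -mulr_natr; field.
have -> : sin z = 2 * (sin t * cos t) by rewrite zt sin_mulr2n -mulr_natr; ring.
have h1 : t * cos t ^+ 2 <= sin t * cos t.
  by rewrite expr2 mulrA ler_wpM2r.
have h2 : t * (1 / 2) <= t * cos t ^+ 2.
  by rewrite ler_wpM2l ?divr_ge0// c2; lra.
by move: h1 h2; rewrite /t; lra.
Qed.

Lemma sqr_le_sin2 (h v : R) : 0 < h -> - (h / 2) <= v <= h / 2 ->
  v ^+ 2 <= h ^+ 2 * sin (2 * pi / h * v / 2) ^+ 2.
Proof.
move=> h0; wlog v0 : v / 0 <= v.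
  move=> H /andP[v1 v2]; have [v0|/ltW v0] := leP 0 v.
    by apply: H => //; apply/andP.
  have := H (- v); rewrite oppr_ge0 => /(_ v0); rewrite mulrN mulNr sinN !sqrrN.
  by apply; apply/andP; split; lra.
move=> /andP[_ vh]; rewrite -exprMn; have pi3 := @pi_ge3 R.
have hn0 : h != 0 by rewrite gt_eqF.
have -> : 2 * pi / h * v / 2 = pi * (v / h) by field.
have vh0 : 0 <= v / h by rewrite divr_ge0// ltW.
have vh2 : v / h <= 2^-1 by rewrite ler_pdivrMr// mulrC.
have := @half_le_sin (pi * (v / h)).
rewrite mulr_ge0 ?pi_ge0//= ler_pM2l ?pi_gt0// => /(_ vh2) hs.
have hs' : v / h <= sin (pi * (v / h)) by apply: le_trans hs; nra.
have : v <= h * sin (pi * (v / h)) by rewrite mulrC -ler_pdivrMr.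
by move=> hv; rewrite ler_sqr ?nnegrE// (le_trans v0).
Qed.

Lemma taylor2 (f f1 f2 : R -> R) (B x0 v r : R) :
  (forall x, has_deriv f x (f1 x)) -> (forall x, has_deriv f1 x (f2 x)) ->
  (forall x, x0 - r <= x <= x0 + r -> `|f2 x| <= B) -> - r <= v <= r ->
  `|f (v + x0) - f x0 - f1 x0 * v| <= B * v ^+ 2.
Proof.
move=> D1 D2 Bf /andP[rv vr].
have mvt (u u' : R -> R) (y : R) : (forall x, has_deriv u x (u' x)) ->
    exists2 c, `|c - x0| <= `|y - x0| & u y - u x0 = u' c * (y - x0).
  move=> Du; have [xy|/ltW yx] := leP x0 y.
  - have [c /andP[c1 c2] E] := MVT_has_deriv xy (fun x _ => Du x).
    by exists c => //; rewrite !ger0_norm ?subr_ge0// lerD2r.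
  - have [c /andP[c1 c2] E] := MVT_has_deriv yx (fun x _ => Du x).
    exists c; last by rewrite -opprB E; ring.
    by rewrite !ler0_norm ?subr_le0// lerN2 lerD2r.
have [c cv ->] := mvt f f1 (v + x0) D1.
have [d dc E] := mvt f1 f2 c D2.
rewrite addrK in cv *; rewrite -mulrBl E !normrM -mulrA.
rewrite -(real_normK (num_real v)) expr2.
apply: ler_pM => //.
  apply: Bf; have : `|d - x0| <= r.
    by apply: le_trans dc _; apply: le_trans cv _; rewrite ler_norml rv.
  by rewrite ler_norml => /andP[]; lra.
by rewrite ler_wpM2r.
Qed.

End Cells.

Lemma geometric_sum_le (R : realType) (q : R) n : 0 <= q -> q < 1 ->
  \sum_(i < n) q ^+ i <= (1 - q)^-1.
Proof.
move=> q0 q1; rewrite -[leRHS]mul1r ler_pdivlMr ?subr_gt0// mulrC.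
have -> : (1 - q) * \sum_(i < n) q ^+ i = 1 - q ^+ n.
  by rewrite -opprB mulNr -subrX1 opprB.
by rewrite gerBl exprn_ge0.
Qed.

Section Comparison.
Local Open Scope classical_set_scope.
Context {R : realType} (sigma h : R) (sigma_gt0 : 0 < sigma) (h_gt0 : 0 < h).
Let w := 2 * pi / h.
Let g := gker sigma 2.
Let g1 x : R := 2 * gker sigma 2 x - gker sigma 3 x.
Let g2 x : R := 2 * (2 * gker sigma 2 x - gker sigma 3 x)
   - (3 * gker sigma 3 x - gker sigma 4 x).
Let hn0 : h != 0. Proof. by rewrite gt_eqF. Qed.

Let g2_le : exists2 K, 0 <= K & forall x, `|g2 x| <= K * expR (- `|x|).
Proof.
pose k s : R := s`!%:R * sigma + s.+2`!%:R / sigma.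
have k0 s : 0 <= k s by rewrite addr_ge0// mulr_ge0 ?ler0n ?invr_ge0 ?(ltW sigma_gt0).
exists (4 * k 1 + 5 * k 2 + k 3).
  by have := k0 1%N; have := k0 2%N; have := k0 3%N; lra.
move=> x; have b s := gker_le sigma_gt0 s x; have p s := gker_ge0 sigma_gt0 s x.
have -> : (4 * k 1%N + 5 * k 2%N + k 3%N) * expR (- `|x|) = 4 * (k 1%N * expR (- `|x|))
  + 5 * (k 2%N * expR (- `|x|)) + k 3%N * expR (- `|x|) by ring.
rewrite /g2; move: (b 1%N) (b 2%N) (b 3%N) (p 2%N) (p 3%N) (p 4%N).
rewrite -/(k 1%N) -/(k 2%N) -/(k 3%N).
move: (gker _ 2 x) (gker _ 3 x) (gker _ 4 x) (k 1%N * _) (k 2%N * _) (k 3%N * _).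
by move=> a2 a3 a4 e1 e2 e3 *; rewrite ler_norml; apply/andP; split; lra.
Qed.

(** The kernel is even, so the linear term of the Taylor expansion of the
    integrand at the centre of the cell drops out, and the quadratic error is
    absorbed by the factor sin^2 in [sin2_fejer_le]: the error is uniform in
    [n]. *)
Let cell_error : exists2 C, 0 <= C & forall n x0,
  `|cint (fun v => g (v + x0) * fejer w n v) (- (h / 2)) (h / 2) - n%:R * (h * g x0)|
  <= C * expR (- `|x0|).
Proof.
have [K K0 gK] := g2_le.
exists (K * expR (h / 2) * h ^+ 2 * h).
  by rewrite !mulr_ge0 ?expR_ge0 ?(ltW h_gt0).
move=> n x0; set B := K * expR (h / 2) * expR (- `|x0|).
have h2 : - (h / 2) <= h / 2 by rewrite ge0_cp ?divr_ge0 ?ltW.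
have cF := @continuous_fejer R w n.
have cgs : continuous (fun v : R => g (v + x0)).
  move=> v; apply: has_deriv_continuous; apply: has_deriv_comp; first exact: has_deriv_gker.
  by apply: has_derivD; [exact: has_deriv_id|exact: has_deriv_cst].
have c1 : continuous (fun v : R => g (v + x0) * fejer w n v).
  by move=> v; apply: cvgM; [exact: cgs|exact: cF].
have c2 : continuous (fun v : R => v * fejer w n v).
  by move=> v; apply: cvgM; [exact: cvg_id|exact: cF].
have -> : cint (fun v => g (v + x0) * fejer w n v) (- (h / 2)) (h / 2)
    - n%:R * (h * g x0) =
  cint (fun v => 1 * (g (v + x0) * fejer w n v) + (- g x0) * fejer w n v
    + (- g1 x0) * (v * fejer w n v)) (- (h / 2)) (h / 2).
  rewrite cint_lin3// cint_fejer// [X in - g1 x0 * X]cint_odd//; first by ring.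
  by move=> v; rewrite fejerN mulNr.
apply: le_trans (_ : B * h ^+ 2 * (h / 2 - - (h / 2)) <= _); last first.
  by rewrite /B le_eqVlt; apply/orP; left; apply/eqP; field.
rewrite -cint_cst; apply: cint_norm_le => //.
- move=> v; apply: cvgD; first apply: cvgD; apply: cvgM;
    by [exact: cvg_cst|exact: c1|exact: c2|exact: cF].
- by move=> v; exact: cvg_cst.
move=> v hv; rewrite (_ : _ + _ = (g (v + x0) - g x0 - g1 x0 * v) * fejer w n v); last by ring.
rewrite normrM; have F0 := normr_ge0 (fejer w n v).
have B0 : 0 <= B by rewrite !mulr_ge0 ?expR_ge0.
have taylor : `|g (v + x0) - g x0 - g1 x0 * v| <= B * v ^+ 2.
  apply: (taylor2 (f2 := g2) (r := h / 2)) => // x.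
  - exact: has_deriv_gker.
  - apply: has_deriv_eq; first apply: has_derivD.
    + by apply: has_derivM; [exact: has_deriv_cst|exact: has_deriv_gker].
    + by apply: has_derivN; exact: has_deriv_gker.
    + by rewrite /g2; ring.
  - move=> /andP[x1 x2]; apply: le_trans (gK x) _.
    rewrite /B -mulrA ler_wpM2l// -expRD ler_expR.
    have : `|x0| <= `|x| + `|x0 - x| by rewrite -{1}(subrK x x0) addrC ler_normD.
    have : `|x0 - x| <= h / 2 by rewrite ler_norml; apply/andP; split; lra.
    by lra.
apply: le_trans (ler_wpM2r F0 taylor) _.
apply: le_trans (_ : B * (h ^+ 2 * sin (w * v / 2) ^+ 2) * `|fejer w n v| <= _).
  by rewrite ler_wpM2r// ler_wpM2l// sqr_le_sin2.
rewrite (_ : _ * `|fejer w n v| =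
  B * h ^+ 2 * (sin (w * v / 2) ^+ 2 * `|fejer w n v|)); last by ring.
by rewrite -[leRHS]mulr1 ler_wpM2l ?sin2_fejer_le// mulr_ge0 ?sqr_ge0.
Qed.

(** The negative nodes are summed apart, as in [cvg_esum_int]. *)
Definition trapezoid M : R :=
  \sum_(i < M.+1) h * gker sigma 2 (i%:R * h) +
  \sum_(i < M) h * gker sigma 2 (- (i.+1%:R * h)).

Lemma trapezoid_error : exists C, forall n M,
  `|cint (fun x => g x * fejer w n x) (- halfwidth h M) (halfwidth h M)
    - n%:R * trapezoid M| <= C.
Proof.
have [C C0 errC] := cell_error; pose q := expR (- h).
have q0 : 0 <= q by exact: expR_ge0.
have q1 : 0 < 1 - q by rewrite subr_gt0 expR_lt1 oppr_lt0.
have geo m : \sum_(i < m) q ^+ i <= (1 - q)^-1.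
  by rewrite geometric_sum_le// -subr_gt0.
have qE m : expR (- `|m%:R * h|) = q ^+ m.
  by rewrite normrM (gtr0_norm h_gt0) normr_nat -mulrN expRM_natl.
exists (C * (1 - q)^-1 *+ 2) => n M.
pose I := cint (fun x => g x * fejer w n x).
have cell (j : int) :
    `|I (- (h / 2) + j%:~R * h) (h / 2 + j%:~R * h) - n%:R * (h * g (j%:~R * h))|
      <= C * expR (- `|j%:~R * h|).
  rewrite /I -cint_shift; last first.
    by move=> x; apply: cvgM; [exact: continuous_gker|exact: continuous_fejer].
  under [X in cint X]eq_fun do rewrite fejer_period//.
  exact: errC.
apply: le_trans (_ : C * \sum_(i < M.+1) q ^+ i + C * \sum_(i < M) q ^+ i.+1 <= _);
  last first.
  rewrite mulr2n lerD ?ler_wpM2l//; apply: le_trans (geo M.+1).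
  by rewrite big_ord_recl expr0 lerDr.
rewrite -/(I _ _) /trapezoid; elim: M => [|M IH].
  have := cell 0; rewrite !big_ord_recl !big_ord0 /halfwidth !mul0r !addr0 add0r.
  by rewrite normr0 oppr0 expR0 expr0 mulr0 addr0 [2^-1 * h]mulrC.
rewrite 2!(big_ord_recr M.+1) [\sum_(i < M.+1) q ^+ i.+1]big_ord_recr.
rewrite [\sum_(i < M.+1) h * gker sigma 2 (- _)]big_ord_recr /=.
have HR := cell M.+1%:Z; rewrite -pmulrn qE in HR.
have HL := cell (- M.+1%:Z); rewrite mulrNz -pmulrn mulNr normrN qE in HL.
have E1 : - (h / 2) + M.+1%:R * h = halfwidth h M by rewrite /halfwidth -natr1; field.
have E2 : h / 2 + M.+1%:R * h = halfwidth h M.+1 by rewrite /halfwidth; field.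
have E3 : - (h / 2) - M.+1%:R * h = - halfwidth h M.+1 by rewrite /halfwidth; field.
have E4 : h / 2 - M.+1%:R * h = - halfwidth h M by rewrite /halfwidth -natr1; field.
rewrite E1 E2 in HR; rewrite E3 E4 in HL.
have <- : I (- halfwidth h M.+1) (- halfwidth h M) +
    I (- halfwidth h M) (halfwidth h M) + I (halfwidth h M) (halfwidth h M.+1) =
  I (- halfwidth h M.+1) (halfwidth h M.+1) by rewrite /I !cint_cat.
move: IH HL HR; rewrite /g !ler_norml.
move: (\sum_(i < M.+1) q ^+ i) (\sum_(i < M) q ^+ i.+1) (q ^+ M.+1).
move: (\sum_(i < M.+1) h * _) (\sum_(i < M) h * _) (h * _) (h * _).
move: (I _ _) (I _ _) (I _ _).
by move=> I1 I2 I3 t1 t2 t3 t4 s1 s2 qM /andP[? ?] /andP[? ?] /andP[? ?];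
  apply/andP; split; lra.
Qed.

End Comparison.

(** * The error of the trapezoidal rule *)

Section Convergence.
Local Open Scope classical_set_scope.
Context {R : realType} (sigma h : R) (sigma_gt0 : 0 < sigma) (h_gt0 : 0 < h).
Let w := 2 * pi / h.
Let q := expR (- (lambda0 R * w)).
Let T := halfwidth h.
Let g := gker sigma 2.

Let w_gt0 : 0 < w.
Proof. by rewrite divr_gt0// mulr_gt0// pi_gt0. Qed.

Let q_ge0 : 0 <= q. Proof. exact: expR_ge0. Qed.

Let q_lt1 : q < 1.
Proof. by rewrite expR_lt1 oppr_lt0 mulr_gt0// lambda0_gt0. Qed.

Lemma delta_geometric n : 4 * \sum_(k < n) q ^+ k.+1 <= delta h.
Proof.
have q0 : 0 < q by exact: expR_gt0.
have d : delta h = 4 * (q / (1 - q)).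
  rewrite /delta; have -> : 2 * pi * lambda0 R / h = lambda0 R * w by rewrite /w; ring.
  have -> : expR (lambda0 R * w) = q^-1 by rewrite /q expRN invrK.
  by rewrite (_ : q^-1 - 1 = (1 - q) / q) ?invf_div//; field; rewrite gt_eqF.
under eq_bigr do rewrite exprS.
by rewrite d -mulr_sumr !ler_wpM2l// geometric_sum_le.
Qed.

Let dirichlet_limit n : exists2 l,
  cint (fun x => g x * dirichlet w n x) (- T M) (T M) @[M --> \oo] --> l &
  `|l - 1| <= 4 * \sum_(k < n) q ^+ k.+1.
Proof.
elim: n => [|n [l cl bl]].
  exists 1; last by rewrite subrr normr0 big_ord0 mulr0.
  have -> : (fun M => cint (fun x => g x * dirichlet w 0 x) (- T M) (T M)) =
      gmass sigma h 2.
    apply/funext => M; congr cint; apply/funext => x.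
    by rewrite /dirichlet big_ord0 mulr0 addr0 mulr1.
  by have := @cvg_gmass R sigma h sigma_gt0 h_gt0 1; rewrite factS fact0.
have [X cX bX] := @gcos_decay R sigma h sigma_gt0 h_gt0 (n.+1%:R * w)
   (mulr_ge0 (ler0n _ _) (ltW w_gt0)).
exists (l + 2 * X).
  have -> : (fun M => cint (fun x => g x * dirichlet w n.+1 x) (- T M) (T M)) =
      (fun M => cint (fun x => g x * dirichlet w n x) (- T M) (T M)
         + 2 * gcos sigma h 2 (n.+1%:R * w) M).
    apply/funext => M; rewrite !cint_mul_dirichlet; try exact: continuous_gker.
    by rewrite big_ord_recr /= mulrDr addrA.
  by apply: cvgD; [exact: cl|apply: cvgM; [exact: cvg_cst|exact: cX]].
rewrite big_ord_recr /= mulrDr addrAC; apply: le_trans (ler_normD _ _) _.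
apply: lerD => //; rewrite normrM ger0_norm//.
have -> : q ^+ n.+1 = expR (- (lambda0 R * (n.+1%:R * w))).
  by rewrite /q -expRM_natl; congr expR; ring.
by have := bX; lra.
Qed.

Let fejer_limit n : exists2 l,
  cint (fun x => g x * fejer w n x) (- T M) (T M) @[M --> \oo] --> l &
  `|l - n%:R| <= n%:R * delta h.
Proof.
have cg := @continuous_gker R sigma 2.
elim: n => [|n [l cl bl]].
  exists 0; last by rewrite subrr normr0 mul0r.
  have -> : (fun M => cint (fun x => g x * fejer w 0 x) (- T M) (T M)) = (fun=> 0).
    by apply/funext => M; rewrite cint_mul_fejer// big_ord0.
  exact: cvg_cst.
have [l' cl' bl'] := dirichlet_limit n.
exists (l + l').
  have -> : (fun M => cint (fun x => g x * fejer w n.+1 x) (- T M) (T M)) =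
      (fun M => cint (fun x => g x * fejer w n x) (- T M) (T M)
         + cint (fun x => g x * dirichlet w n x) (- T M) (T M)).
    by apply/funext => M; rewrite !cint_mul_fejer// big_ord_recr.
  by apply: cvgD; [exact: cl|exact: cl'].
rewrite -natr1 opprD addrACA mulrDl mul1r.
apply: le_trans (ler_normD _ _) _; apply: lerD => //.
exact: le_trans bl' (delta_geometric n).
Qed.

(** The error term of [trapezoid_error] does not grow with the order [n] of the
    kernel, whereas the main terms are proportional to [n]. *)
Lemma trapezoid_limit (e : R) : 0 < e ->
  \forall M \near \oo, `|trapezoid sigma h M - 1| <= delta h + e.
Proof.
move=> e0; have [C errC] := @trapezoid_error R sigma h sigma_gt0 h_gt0.
pose n := (Num.truncn ((C + 1) / e)).+1.
have n0 : 0 < n%:R :> R by rewrite ltr0n.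
have nC : C + 1 <= n%:R * e.
  by rewrite -ler_pdivrMr// ltW// truncnS_gt.
have [l cl bl] := fejer_limit n.
have /cvgrPdist_le cl' := cl.
near=> M.
have h1 : `|l - cint (fun x => g x * fejer w n x) (- T M) (T M)| <= 1.
  by near: M; exact: cl'.
have h2 := errC n M; rewrite -/w -/g -/T in h2.
rewrite -(ler_pM2l n0) -{1}(gtr0_norm n0) -normrM.
move: h1 h2 bl nC; rewrite !ler_norml.
move: (cint _ _ _) => I /andP[? ?] /andP[? ?] /andP[? ?] nC.
by rewrite mulrBr mulr1 mulrDr; apply/andP; split; lra.
Unshelve. all: by end_near. Qed.

End Convergence.

(** * Sums over the integers *)

Section BilateralSum.
Local Open Scope classical_set_scope.
Context {R : realType}.

(** The nonnegative and the negative integers contribute two series of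
    nonnegative terms, whose partial sums are added. *)
Lemma cvg_esum_int (u : int -> R) : (forall n, 0 <= u n) ->
  (\sum_(i < M.+1) u i%:Z + \sum_(i < M) u (- i.+1%:Z))%:E @[M --> \oo]
    --> (\esum_(n in [set: int]) (u n)%:E)%E.
Proof.
move=> u0; have u0' n : (0 <= (u n)%:E)%E by rewrite lee_fin.
have -> : (\esum_(n in [set: int]) (u n)%:E =
    \sum_(n <oo) (u n%:Z)%:E + \sum_(n <oo) (u (- n.+1%:Z))%:E)%E.
  rewrite (esumID (range Posz))// !setTI; congr (_ + _)%E.
    by rewrite esum_image ?nneseries_esumT// => x y _ _ [].
  rewrite (_ : ~` range Posz = range (fun n : nat => - n.+1%:Z)).
    by rewrite esum_image ?nneseries_esumT// => x y _ _ /oppr_inj[].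
  apply/seteqP; split=> [[n|n] /= nP|_ [n _ <-] [m _]//].
  - by case: nP; exists n.
  - by exists n => //; rewrite NegzE.
have p1 : (0 <= \sum_(n <oo) (u n%:Z)%:E)%E by exact: nneseries_ge0.
have p2 : (0 <= \sum_(n <oo) (u (- n.+1%:Z))%:E)%E by exact: nneseries_ge0.
have c1 : (\sum_(0 <= i < M) (u i%:Z)%:E)%E @[M --> \oo] -->
    (\sum_(n <oo) (u n%:Z)%:E)%E by exact: is_cvg_nneseries.
have c2 : (\sum_(0 <= i < M) (u (- i.+1%:Z))%:E)%E @[M --> \oo] -->
    (\sum_(n <oo) (u (- n.+1%:Z))%:E)%E by exact: is_cvg_nneseries.
have -> : (fun M => (\sum_(i < M.+1) u i%:Z + \sum_(i < M) u (- i.+1%:Z))%:E) =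
  (fun M => \sum_(0 <= i < M.+1) (u i%:Z)%:E + \sum_(0 <= i < M) (u (- i.+1%:Z))%:E)%E.
  by apply/funext => M; rewrite EFinD -!sumEFin !big_mkord.
apply: cvgeD; first exact: ge0_adde_def; last exact: c2.
by rewrite -cvg_shiftS in c1.
Qed.

End BilateralSum.

Lemma exp_term_gker (R : realType) (h t : R) (n : int) : 0 <= t ->
  a h n * expR (- b h n * t) = (1 + t) ^- 2 * (h * gker (1 + t) 2 (n%:~R * h)).
Proof.
move=> t0; have s0 : 1 + t != 0 by rewrite gt_eqF// ltr_pwDl.
rewrite /a /b /gker; set x := n%:~R * h.
have -> : 2 * n%:~R * h - expR x = 2%:R * x - expR x by rewrite /x; ring.
rewrite -mulrA -expRD -addrA expRD expRM_natl.
have -> : - expR x + - expR x * t = - ((1 + t) * expR x) by ring.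
by field.
Qed.

Theorem proposition2p4 (R : realType) (h t : R) (h_gt0 : 0 < h) (t_ge0 : 0 <= t) :
  (`| (1 / (1 + t) ^+ 2)%:E - exp_sum h t | <= (delta h / (1 + t) ^+ 2)%:E)%E.
Proof.
have s_gt0 : 0 < 1 + t by rewrite ltr_pwDl.
have s2_gt0 : 0 < (1 + t) ^- 2 by rewrite invr_gt0 exprn_gt0.
have term n := exp_term_gker h n t_ge0.
have term_ge0 n : 0 <= a h n * expR (- b h n * t).
  by rewrite mulr_ge0 ?expR_ge0// /a mulr_ge0 ?expR_ge0// ltW.
have := cvg_esum_int term_ge0; rewrite -/(exp_sum h t).
have -> : (fun M => (\sum_(i < M.+1) a h i%:Z * expR (- b h i%:Z * t)
    + \sum_(i < M) a h (- i.+1%:Z) * expR (- b h (- i.+1%:Z) * t))%:E) =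
    (fun M => ((1 + t) ^- 2 * trapezoid (1 + t) h M)%:E).
  apply/funext => M; congr EFin; rewrite /trapezoid mulrDr !mulr_sumr.
  congr (_ + _); apply: eq_bigr => i _; rewrite term //.
  by rewrite mulrNz -pmulrn mulNr.
move=> cvgS.
have bounds e : 0 < e -> (((1 + t) ^- 2 * (1 - (delta h + e)))%:E <= exp_sum h t
    <= ((1 + t) ^- 2 * (1 + (delta h + e)))%:E)%E.
  move=> e0; have lim := trapezoid_limit s_gt0 h_gt0 e0.
  rewrite -(cvg_lim (@ereal_hausdorff R) cvgS); apply/andP; split.
  - apply: lime_ge; first exact: cvgP cvgS.
    near=> M; rewrite lee_fin ler_wpM2l ?(ltW s2_gt0)//.
    suff : `|trapezoid (1 + t) h M - 1| <= delta h + e.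
      by rewrite ler_norml => /andP[]; lra.
    by near: M.
  - apply: lime_le; first exact: cvgP cvgS.
    near=> M; rewrite lee_fin ler_wpM2l ?(ltW s2_gt0)//.
    suff : `|trapezoid (1 + t) h M - 1| <= delta h + e.
      by rewrite ler_norml => /andP[]; lra.
    by near: M.
have fin : exp_sum h t \is a fin_num.
  have /andP[lo hi] := bounds 1 ltr01.
  by rewrite fin_numE gt_eqF ?lt_eqF// ?(le_lt_trans hi) ?(lt_le_trans _ lo)// ?ltry ?ltNyr.
move: bounds; rewrite -(fineK fin); set S := fine _ => bounds.
rewrite -EFinB /= lee_fin; apply/ler_addgt0Pr => e e0.
have := bounds (e * (1 + t) ^+ 2); rewrite mulr_gt0 ?exprn_gt0// !lee_fin => /(_ isT).
have t1 : 1 + t != 0 by rewrite gt_eqF.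
have -> : (1 + t) ^- 2 * (1 - (delta h + e * (1 + t) ^+ 2)) =
  1 / (1 + t) ^+ 2 - (delta h / (1 + t) ^+ 2 + e) by field.
have -> : (1 + t) ^- 2 * (1 + (delta h + e * (1 + t) ^+ 2)) =
  1 / (1 + t) ^+ 2 + (delta h / (1 + t) ^+ 2 + e) by field.
by rewrite distrC ler_distl.
Unshelve. all: by end_near. Qed.
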